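(* An $HA_\infty$-algebra structure on a graded vector space $A$ with respect to a linear map $\alpha:A\to A$ of degree $0$ is equivalent to an element $D\in\mathrm{Coder}^{-1}_\alpha(TV)$ with $D\circ D=0$, where $V=sA$.
   Context: All vector spaces are over a field of characteristic zero; the Koszul sign rule is used throughout; $\alpha$ is assumed not identically zero. An $HA_\infty$-algebra structure on a graded vector space $A=\oplus A_i$ with respect to a degree $0$ linear map $\alpha:A\to A$ is a collection of linear maps $\mu_k:A^{\otimes k}\to A$ of degree $k-2$ ($k\ge1$) with $\alpha\circ\mu_k=\mu_k\circ\alpha^{\otimes k}$ for all $k$, such that for all $n\ge1$ $$\sum_{r+s+t=n,\ r,t\ge0,\ s\ge1}(-1)^{rs+t}\,\mu_{r+1+t}\big((\alpha^{s-1})^{\otimes r}\otimes\mu_s\otimes(\alpha^{s-1})^{\otimes t}\big)=0 .$$ Suspension: $sA$ is the graded vector space with $(sA)_i=A_{i-1}$. The map $\alpha$ induces a degree $0$ map on $V=sA$, denoted by the same symbol. Twisted coderivations: for a graded vector space $V$ with a degree $0$ linear map $\alpha:V\to V$, let $TV=\oplus_{k\ge0}V^{\otimes k}$. For a homogeneous linear map $\varrho:V^{\otimes n}\to V$ with $\alpha\circ\varrho=\varrho\circ\alpha^{\otimes n}$, define $\widetilde\varrho:TV\to TV$ to be $0$ on $V^{\otimes k}$ for $k<n$, and for $k\ge n$ $$\widetilde{\varrho}(v_1\otimes\cdots\otimes v_k)=\sum_{i=0}^{k-n}(-1)^{|\varrho|(|v_1|+\cdots+|v_i|)}\alpha^{n-1}v_1\otimes\cdots\otimes\alpha^{n-1}v_i\otimes\varrho(v_{i+1}\otimes\cdots\otimes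 v_{i+n})\otimes\alpha^{n-1}v_{i+n+1}\otimes\cdots\otimes\alpha^{n-1}v_k .$$ $\mathrm{Coder}^p_\alpha(TV)$ is the space of all $D=\sum_{n\ge1}\widetilde{\varrho_n}$ where each $\varrho_n:V^{\otimes n}\to V$ has degree $p$ and satisfies $\alpha\circ\varrho_n=\varrho_n\circ\alpha^{\otimes n}$. $D\circ D$ is composition of maps $TV\to TV$. *)

(* Defs.v *)
From HB Require Import structures.
From mathcomp Require Import all_boot all_order all_algebra.
From mathcomp Require Import boolp classical_sets functions fsbigop.
From mathcomp Require Import freeg zify.

Set Implicit Arguments.
Unset Strict Implicit.
Unset Printing Implicit Defensive.

Import GRing.Theory.
Local Open Scope classical_set_scope.
Local Open Scope ring_scope.

(* Tensor spaces.  [X] is a type of words over [V] (read through [wd]) and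
   [tensor wd] is the free K-module on [X] modulo the submodule generated by
   the multilinearity relations.  Two instances are used:
     [tpow V n] = V^{(x) n}                 (X = n.-tuple V),
     [talg V]   = TV = (+)_{n >= 0} V^{(x) n}  (X = seq V);
   the relations are homogeneous for the length of words, so that the quotient
   over all words is the direct sum of the tensor powers. *)
Section Tensor.
Variables (K : fieldType) (V : lmodType K) (X : choiceType) (wd : X -> seq V).
Local Notation F := {freeg X / K}.

Definition multilin_rel : set F :=
  [set r | exists x y z u v c a b,
    [/\ wd x = u ++ (c *: a + b) :: v, wd y = u ++ a :: v, wd z = u ++ b :: v
      & r = << x >> - (c *: << y >> + << z >>)]].

Definition submodule (S : set F) :=
  S 0 /\ forall c x y, S x -> S y -> S (c *: x + y).

Definition relspan : {pred F} :=
  [pred x : F | `[< smallest submodule multilin_rel x >]].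

Lemma relspanP x : reflect (smallest submodule multilin_rel x) (x \in relspan).
Proof. exact: asboolP. Qed.

Lemma relspanZD c x y :
  x \in relspan -> y \in relspan -> c *: x + y \in relspan.
Proof.
move=> /relspanP hx /relspanP hy; apply/relspanP => S [sS rS].
by apply: sS.2; [apply: hx | apply: hy].
Qed.

Lemma relspan0 : 0 \in relspan.
Proof. by apply/relspanP => S [[]]. Qed.

Lemma relspan_zmod : zmod_closed relspan.
Proof.
split=> [|x y hx hy]; first exact: relspan0.
by rewrite addrC -scaleN1r; apply: relspanZD.
Qed.
HB.instance Definition _ := GRing.isZmodClosed.Build F relspan relspan_zmod.

Definition tensor := Quotient.quot relspan.
HB.instance Definition _ := GRing.Zmodule.on tensor.

Definition tclass (x : F) : tensor := (\pi_tensor x)%qT.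

Lemma tclass_eq x y : (tclass x = tclass y) <-> (x - y \in relspan).
Proof. by rewrite Quotient.idealrBE; split=> /eqP. Qed.

Lemma tclassK t : tclass (repr t) = t.
Proof. exact: reprK. Qed.

Lemma tclassD x y : tclass (x + y) = tclass x + tclass y.
Proof. exact: Quotient.pi_add. Qed.

Lemma tclass0 : tclass 0 = 0.
Proof. by apply: (addrI (tclass 0)); rewrite -tclassD !addr0. Qed.

Definition tscale (c : K) (t : tensor) : tensor := tclass (c *: repr t).

Lemma tclassZ c x : tclass (c *: x) = tscale c (tclass x).
Proof.
apply/tclass_eq; rewrite -scalerBr -[_ *: _]addr0; apply: relspanZD relspan0.
by apply/tclass_eq; rewrite tclassK.
Qed.

Lemma tscaleA c d t : tscale c (tscale d t) = tscale (c * d) t.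
Proof. by rewrite -[t]tclassK -!tclassZ scalerA. Qed.
Lemma tscale1 : left_id 1 tscale.
Proof. by move=> t; rewrite -[t]tclassK -tclassZ scale1r. Qed.
Lemma tscaleDr : right_distributive tscale +%R.
Proof.
by move=> c s t; rewrite -[s]tclassK -[t]tclassK -tclassD -!tclassZ scalerDr tclassD.
Qed.
Lemma tscaleDl t : {morph tscale^~ t : c d / c + d}.
Proof. by move=> c d; rewrite -[t]tclassK -!tclassZ scalerDl tclassD. Qed.
HB.instance Definition _ :=
  GRing.Zmodule_isLmodule.Build K tensor tscaleA tscale1 tscaleDr tscaleDl.

Lemma tclass_linear : linear tclass.
Proof. by move=> c x y; rewrite tclassD tclassZ. Qed.

Definition pure (x : X) : tensor := tclass << x >>.

Definition multilinear (W : lmodType K) (f : X -> W) :=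
  forall x y z u v c a b,
    wd x = u ++ (c *: a + b) :: v -> wd y = u ++ a :: v -> wd z = u ++ b :: v ->
    f x = c *: f y + f z.

Lemma pure_multilinear : multilinear pure.
Proof.
move=> x y z u v c a b hx hy hz; rewrite /pure -tclass_linear.
by apply/tclass_eq/relspanP; apply: sub_gen_smallest; exists x, y, z, u, v, c, a, b.
Qed.

(* The linear map out of [tensor] induced by [f : X -> W]; meaningful only for
   multilinear [f], see [tliftE] and [tlift_linear]. *)
Definition tlift (W : lmodType K) (f : X -> W) (t : tensor) : W :=
  fglift f (repr t).

Lemma fglift_linear (W : lmodType K) (f : X -> W) : linear (fglift f : F -> W).
Proof.
have fD : additive (fglift f : F -> W) by exact: lift_is_additive.
have fB x y : fglift f (x - y) = fglift f x - fglift f y := fD x y.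
have f0 : fglift f 0 = 0 by rewrite -[0 in LHS](subrr 0) fB subrr.
have fP x y : fglift f (x + y) = fglift f x + fglift f y.
  by rewrite -[y in LHS]opprK fB -[- y]add0r fB f0 sub0r opprK.
have fS (I : Type) (s : seq I) (G : I -> F) :
    fglift f (\sum_(i <- s) G i) = \sum_(i <- s) fglift f (G i).
  by elim/big_rec2: _ => // i y1 y2 _ <-; rewrite fP.
have fU k x : fglift f (<< k *g x >> : F) = k *: f x by exact: liftU.
move=> c x y; rewrite fP; congr (_ + _).
rewrite -{2}[x]freeg_sumE fS scaler_sumr.
have -> : c *: x = \sum_(i <- dom x) << c * coeff i x *g i >> by [].
by rewrite fS; apply: eq_bigr => i _; rewrite !fU scalerA.
Qed.

Lemma tlift_class (W : lmodType K) (f : X -> W) (x : F) :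
  multilinear f -> tlift f (tclass x) = fglift f x.
Proof.
move=> fM; have fL := fglift_linear f.
have f0 : fglift f 0 = 0.
  by have := fL 1 0 0; rewrite !scale1r addr0 => /(congr1 (fun w => w - fglift f 0));
     rewrite addrK subrr.
suff S (r : F) : r \in relspan -> fglift f r = 0.
  have : repr (tclass x) - x \in relspan by apply/tclass_eq; rewrite tclassK.
  move/S; rewrite -scaleN1r addrC fL scaleN1r addrC => /eqP.
  by rewrite subr_eq0 => /eqP.
move/relspanP; apply: (smallest_sub (C := submodule) (X := [set r | fglift f r = 0])).
  by split=> //= c a b; rewrite /= fL => -> ->; rewrite scaler0 addr0.
move=> _ [x' [y [z [u [v [c [a [b [hx hy hz ->]]]]]]]]] /=.
rewrite -scaleN1r addrC !fL.
have fU k w : fglift f (<< k *g w >> : F) = k *: f w by exact: liftU.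
by rewrite !fU !scale1r (fM _ _ _ _ _ _ _ _ hx hy hz) scaleN1r addrC subrr.
Qed.

Lemma tliftE (W : lmodType K) (f : X -> W) (x : X) :
  multilinear f -> tlift f (pure x) = f x.
Proof.
move=> fM; rewrite tlift_class //.
by have -> : fglift f (<< x >> : F) = 1 *: f x by [exact: liftU]; rewrite scale1r.
Qed.

Lemma tlift_linear (W : lmodType K) (f : X -> W) :
  multilinear f -> linear (tlift f).
Proof.
move=> fM c s t; rewrite -[s]tclassK -[t]tclassK -tclass_linear !tlift_class //.
exact: fglift_linear.
Qed.

End Tensor.

Section TensorPowers.
Variables (K : fieldType) (V : lmodType K).

Definition tpow (n : nat) := tensor (fun w : n.-tuple V => tval w).

Definition tens n (w : n.-tuple V) : tpow n := pure _ w.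

(* [tensl n w] = w_1 (x) ... (x) w_n, for a list [w] of length [n] *)
Definition tensl n (w : seq V) : tpow n := tens [tuple nth 0 w i | i < n].

Definition talg := tensor (@id (seq V)).

Definition word (w : seq V) : talg := pure _ w.

(* A family of maps V^{(x) n} -> V, n >= 1; the n-th one is [f n.-1]. *)
Definition opfam := forall n : nat, tpow n.+1 -> V.

Lemma word_multilinear u v c a b :
  word (u ++ (c *: a + b) :: v) = c *: word (u ++ a :: v) + word (u ++ b :: v).
Proof. exact: (@pure_multilinear _ _ _ id). Qed.

Lemma tensl_multilinear n u v c a b : (size u + (size v).+1)%N = n ->
  tensl n (u ++ (c *: a + b) :: v)
  = c *: tensl n (u ++ a :: v) + tensl n (u ++ b :: v).
Proof.
move=> hn.
have E w : size w = n -> tval [tuple nth 0 w i | i < n] = w.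
  move=> hw; apply: (@eq_from_nth _ 0); rewrite size_tuple ?hw // => i hi.
  by rewrite -[i]/(val (Ordinal hi)) -tnth_nth tnth_mktuple.
by apply: (pure_multilinear (u := u) (v := v) (a := a) (b := b));
   rewrite E // size_cat.
Qed.

End TensorPowers.

(* A grading V = (+)_{i in Z} V_i, given by the projections onto the V_i. *)
Record grading (K : fieldType) (V : lmodType K) := Grading {
  proj : int -> V -> V;
  proj_linear : forall i, linear (proj i);
  projK : forall i j x, proj i (proj j x) = if i == j then proj j x else 0;
  proj_sum : forall x, exists2 s : seq int, uniq s & x = \sum_(i <- s) proj i x
}.

Section Suspension.
Variables (K : fieldType) (V : lmodType K) (G : grading V).

(* The suspension has the same underlying space, regraded by (sV)_i = V_{i-1};
   s : V -> sV is the identity of the underlying space, of degree 1. *)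
Definition susp_proj (i : int) : V -> V := proj G (i - 1).

Lemma susp_projK i j x :
  susp_proj i (susp_proj j x) = if i == j then susp_proj j x else 0.
Proof. by rewrite /susp_proj projK (inj_eq (addIr _)). Qed.

Lemma susp_proj_sum x :
  exists2 s : seq int, uniq s & x = \sum_(i <- s) susp_proj i x.
Proof.
have [s us xE] := proj_sum G x; exists [seq i + 1 | i <- s].
  by rewrite map_inj_uniq //; exact: addIr.
by rewrite big_map [LHS]xE; apply: eq_bigr => i _; rewrite /susp_proj addrK.
Qed.

Definition susp : grading V :=
  Grading (fun i => proj_linear G (i - 1)) susp_projK susp_proj_sum.

End Suspension.

Section GradedMaps.
Variables (K : fieldType) (V : lmodType K) (G : grading V).

Definition homog (i : int) (x : V) : Prop := proj G i x = x.

Definition homog_tuple n (d : n.-tuple int) (x : n.-tuple V) : Prop :=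
  forall i, homog (tnth d i) (tnth x i).

Definition has_degree0 (f : V -> V) : Prop :=
  forall i x, homog i x -> homog i (f x).

Definition tpow_degree n (p : int) (f : tpow V n -> V) : Prop :=
  forall (d : n.-tuple int) (x : n.-tuple V), homog_tuple d x ->
    homog (\sum_(i <- d) i + p) (f (tens x)).

(* alpha o f = f o alpha^{(x) n} *)
Definition tpow_commutes n (alpha : V -> V) (f : tpow V n -> V) : Prop :=
  forall x : n.-tuple V, alpha (f (tens x)) = f (tens (map_tuple alpha x)).

Definition sgn (m : int) : K := (-1) ^ m.

(* The linear map x |-> (-1)^{p |x|} x, through which Koszul signs are extended
   to non-homogeneous elements. *)
Definition ksign (p : int) (x : V) : V :=
  \sum_(i \in [set: int]) sgn (p * i) *: proj G i x.

Lemma proj_lin0 i : proj G i 0 = 0.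
Proof.
have := proj_linear G i 1 0 0; rewrite !scale1r addr0.
by move/(congr1 (fun w => w - proj G i 0)); rewrite addrK subrr.
Qed.

Lemma proj_supp x :
  exists s : seq int, forall i, i \notin s -> proj G i x = 0.
Proof.
have [s _ xE] := proj_sum G x; exists s => i; rewrite xE.
have pD y z : proj G i (y + z) = proj G i y + proj G i z.
  by rewrite -[y]scale1r proj_linear !scale1r.
elim: s {xE} => [|j s IH]; first by rewrite big_nil proj_lin0.
rewrite inE negb_or big_cons pD projK => /andP[/negPf-> /IH->].
by rewrite addr0.
Qed.

Lemma ksignE p x (s : seq int) : uniq s ->
  (forall i, i \notin s -> proj G i x = 0) ->
  ksign p x = \sum_(i <- s) sgn (p * i) *: proj G i x.
Proof.
move=> us hs; rewrite /ksign (fsbigE s) //; last first.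
  by move=> i _ /hs ->; rewrite scaler0.
by apply: eq_bigl => i; rewrite in_setT.
Qed.

Lemma ksign_linear p : linear (ksign p).
Proof.
move=> c x y; have [sx hx] := proj_supp x; have [sy hy] := proj_supp y.
have us := undup_uniq (sx ++ sy).
have hs i : i \notin undup (sx ++ sy) -> proj G i x = 0 /\ proj G i y = 0.
  by rewrite mem_undup mem_cat negb_or => /andP[/hx-> /hy->].
rewrite (ksignE p us (fun i hi => (hs i hi).1)).
rewrite (ksignE p us (fun i hi => (hs i hi).2)) (ksignE p us); last first.
  by move=> i /hs[x0 y0]; rewrite proj_linear x0 y0 scaler0 addr0.
rewrite scaler_sumr -big_split; apply: eq_bigr => i _ /=.
by rewrite proj_linear scalerDr !scalerA mulrC.
Qed.

Lemma ksign_homog p d x : homog d x -> ksign p x = sgn (p * d) *: x.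
Proof.
move=> hx; rewrite (ksignE p (s := [:: d])) // => [|i].
  by rewrite big_seq1 hx.
by rewrite inE -hx projK => /negPf->.
Qed.

End GradedMaps.

Section TwistedCoderivations.
Variables (K : fieldType) (V : lmodType K) (G : grading V) (alpha : V -> V).

(* The summand of rho~(v_1 (x) ... (x) v_k) in which rho : V^{(x) n+1} -> V, of
   degree p, is applied to v_{i+1}, ..., v_{i+n+1}; [ksign] accounts for the
   sign (-1)^{p (|v_1| + ... + |v_i|)}, see [tilde_word]. *)
Definition tilde_term (p : int) n (rho : tpow V n.+1 -> V) (i : nat)
    (v : seq V) : talg V :=
  word ([seq iter n alpha (ksign G p x) | x <- take i v]
        ++ rho (tensl n.+1 (take n.+1 (drop i v)))
        :: [seq iter n alpha x | x <- drop (i + n.+1) v]).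

(* rho~ : TV -> TV; the sum is empty on words of length k < n+1. *)
Definition tilde (p : int) n (rho : tpow V n.+1 -> V) : talg V -> talg V :=
  tlift (fun v : seq V =>
    \sum_(0 <= i < size v - n) tilde_term p rho i v).

(* sum_{n >= 1} rho~_n *)
Definition coder (p : int) (rho : opfam V) (t : talg V) : talg V :=
  \sum_(n \in [set: nat]) tilde p (rho n) t.

Definition Coder (p : int) : set (talg V -> talg V) :=
  [set D | exists rho : opfam V,
    [/\ forall n, linear (rho n),
        forall n, tpow_degree G p (rho n),
        forall n, tpow_commutes alpha (rho n)
      & D = coder p rho]].

Lemma map_linear_word (f : V -> V) u v (c : K) a b : linear f ->
  [seq f x | x <- u ++ (c *: a + b) :: v]
  = [seq f x | x <- u] ++ (c *: f a + f b) :: [seq f x | x <- v].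
Proof. by move=> fL; rewrite map_cat /= fL. Qed.

Lemma tilde_multilinear p n (rho : tpow V n.+1 -> V) :
  linear alpha -> linear rho ->
  multilinear id (fun v : seq V =>
    \sum_(0 <= i < size v - n) tilde_term p rho i v).
Proof.
move=> aL rL x y z u v c a b /= -> -> ->; rewrite !size_cat /= scaler_sumr -big_split.
rewrite !big_nat; apply: eq_bigr => i /andP[_ hi] /=.
have iL : linear (iter n alpha).
  by elim: (n) => // m IH d s t; rewrite !iterS IH aL.
have ksL : linear (fun x => iter n alpha (ksign G p x)).
  by move=> d s t; rewrite ksign_linear iL.
rewrite /tilde_term; case: (ltnP (size u) i) => hu.
  have E (w : V) : [/\ take i (u ++ w :: v) = u ++ w :: take (i - (size u).+1) v,
      drop i (u ++ w :: v) = drop (i - (size u).+1) v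
      & drop (i + n.+1) (u ++ w :: v) = drop (i + n.+1 - (size u).+1) v].
    rewrite take_cat !drop_cat !ltnNge (ltnW hu) (leq_trans (ltnW hu) (leq_addr _ _)) /=.
    rewrite -[(i - size u)%N]prednK ?subn_gt0 //.
    rewrite -[(i + n.+1 - size u)%N]prednK ?subn_gt0 ?(leq_trans hu (leq_addr _ _)) //.
    by rewrite /= !subnS.
  have [-> -> ->] := E (c *: a + b); have [-> -> ->] := E a.
  have [-> -> ->] := E b.
  by rewrite !map_cat /= ksL -!catA !cat_cons word_multilinear.
have E1 (w : seq V) : take i (u ++ w) = take i u.
  by rewrite take_cat; case: ltngtP hu => // -> _; rewrite subnn take0 take_size cats0.
have E2 (w : seq V) : drop i (u ++ w) = drop i u ++ w.
  by rewrite drop_cat; case: ltngtP hu => // -> _; rewrite subnn drop0 drop_size.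
rewrite !E1 !E2; case: (ltnP (size u) (i + n.+1)) => hu2.
  have sd : (size (drop i u) < n.+1)%N by rewrite size_drop ltn_subLR.
  have E3 w : take n.+1 (drop i u ++ w :: v)
      = drop i u ++ w :: take (n - size (drop i u)) v.
    by rewrite take_cat ltnNge (ltnW sd) /= subSn.
  have E4 w : drop (i + n.+1) (u ++ w :: v) = drop (i + n - size u) v.
    by rewrite drop_cat ltnNge (ltnW hu2) /= addnS subSn // -ltnS -addnS.
  rewrite !E3 !E4 tensl_multilinear ?rL ?word_multilinear //.
  rewrite size_takel; first by rewrite addnS subnKC.
  by move: hu hi; rewrite size_drop; move: (size u) (size v) => su sv; lia.
have sd : (n.+1 <= size (drop i u))%N by rewrite size_drop leq_subRL.
have E3 w : take n.+1 (drop i u ++ w) = take n.+1 (drop i u).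
  rewrite take_cat; case: (ltngtP n.+1 (size (drop i u))) sd => // -> _.
  by rewrite subnn take0 take_size cats0.
have E4 w : drop (i + n.+1) (u ++ w) = drop (i + n.+1) u ++ w.
  by rewrite drop_cat; case: ltngtP hu2 => // -> _; rewrite subnn drop0 drop_size.
have E5 (s1 s2 s3 : seq V) q w :
    s1 ++ q :: (s2 ++ w :: s3) = (s1 ++ q :: s2) ++ w :: s3.
  by rewrite -catA cat_cons.
by rewrite !E3 !E4 (map_linear_word _ _ _ _ _ iL) // !map_cat /= !E5 word_multilinear.
Qed.

Lemma tilde_linear p n (rho : tpow V n.+1 -> V) :
  linear alpha -> linear rho -> linear (tilde p rho).
Proof. by move=> aL rL; apply/tlift_linear/tilde_multilinear. Qed.

(* The defining formula of rho~ on words of homogeneous elements. *)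
Lemma tilde_word p n (rho : tpow V n.+1 -> V) k
    (d : k.-tuple int) (v : k.-tuple V) :
  linear alpha -> linear rho -> homog_tuple G d v ->
  tilde p rho (word v) =
  \sum_(0 <= i < k - n) sgn K (p * \sum_(j <- take i d) j) *:
    word ([seq iter n alpha x | x <- take i v]
          ++ rho (tensl n.+1 (take n.+1 (drop i v)))
          :: [seq iter n alpha x | x <- drop (i + n.+1) v]).
Proof.
move=> aL rL hv; rewrite /tilde tliftE; last exact: tilde_multilinear.
rewrite size_tuple !big_nat; apply: eq_bigr => i /andP[_ ik].
have {}ik : (i <= k)%N by lia.
have iL : linear (iter n alpha).
  by elim: (n) => // m IH c s t; rewrite !iterS IH aL.
have i0 : iter n alpha 0 = 0.
  by have := iL 1 0 0; rewrite !scale1r addr0 => /(congr1 (fun w => w - iter n alpha 0));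
     rewrite addrK subrr.
rewrite /tilde_term; move: (_ :: _) => w.
have wZ c x u1 u2 : word (u1 ++ (c *: x) :: u2) = c *: word (u1 ++ x :: u2) :> talg V.
  have w0 : word (u1 ++ 0 :: u2) = 0 :> talg V.
    have := word_multilinear u1 u2 1 0 0; rewrite !scale1r addr0.
    by move/(congr1 (fun w => w - word (u1 ++ 0 :: u2))); rewrite addrK subrr.
  by rewrite -[c *: x]addr0 word_multilinear w0 addr0.
have hd j : (j < i)%N -> homog G (nth 0 (take i d) j) (nth 0 (take i v) j).
  move=> ji; rewrite !nth_take //; have jk := leq_trans ji ik.
  by have := hv (Ordinal jk); rewrite !(tnth_nth 0).
have sd : size (take i d) = i by rewrite size_takel ?size_tuple.
have sv : size (take i v) = i by rewrite size_takel ?size_tuple.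
suff aux pre ds vs : size ds = size vs ->
    (forall j, (j < size vs)%N -> homog G (nth 0 ds j) (nth 0 vs j)) ->
    word (pre ++ [seq iter n alpha (ksign G p x) | x <- vs] ++ w) =
    sgn K (p * \sum_(j <- ds) j) *:
      word (pre ++ [seq iter n alpha x | x <- vs] ++ w) :> talg V.
  by apply: (aux [::]) => [|j]; rewrite ?sd sv //; exact: hd.
have iZ c y : iter n alpha (c *: y) = c *: iter n alpha y.
  by rewrite -[c *: y]addr0 iL i0 addr0.
elim: vs pre ds => [|x vs IH] pre [|e ds] //= hs hh.
  by rewrite big_nil mulr0 /sgn expr0z scale1r.
rewrite (ksign_homog p (hh 0%N isT)) iZ wZ -cat_rcons (IH _ ds) => [|| j ji].
- by rewrite cat_rcons scalerA big_cons mulrDr /sgn exprzDr ?unitrN1.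
- by case: hs.
- exact: (hh j.+1).
Qed.

End TwistedCoderivations.

Section HAinfinity.
Variables (K : fieldType) (A : lmodType K) (G : grading A) (alpha : A -> A).

(* HA_infinity-algebra structures on A with respect to alpha.  The last clause
   is the defining identity evaluated on homogeneous a_1, ..., a_n of degrees
   d_1, ..., d_n, with mu_{s+1} of degree s-1 in the role of mu_s: the Koszul
   rule gives the additional sign (-1)^{(s-1) (d_1 + ... + d_r)}. *)
Definition HAinf : set (opfam A) :=
  [set mu : opfam A |
    [/\ forall k, linear (mu k),
        forall k, tpow_degree G (k.+1%:Z - 2) (mu k),
        forall k, tpow_commutes alpha (mu k)
      & forall n (d : n.-tuple int) (a : n.-tuple A),
          (0 < n)%N -> homog_tuple G d a ->
          \sum_(r < n) \sum_(s < n) \sum_(t < n | (r + s.+1 + t)%N == n)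
            sgn K (r * s.+1 + t)%N *:
            (sgn K ((s.+1%:Z - 2) * \sum_(i <- take r d) i) *:
             mu (r + t)%N (tensl (r + t).+1
               ([seq iter s alpha x | x <- take r a]
                ++ mu s (tensl s.+1 (take s.+1 (drop r a)))
                :: [seq iter s alpha x | x <- drop (r + s.+1) a]))) = 0]].

(* (s^{-1})^{(x) k} : (sA)^{(x) k} -> A^{(x) k}.  By the Koszul rule it maps
   v_1 (x) ... (x) v_k to itself up to the sign (-1)^{sum_j (k-j) |v_j|}, with
   |v_j| the degree in sA. *)
Definition desusp k : tpow A k -> tpow A k :=
  tlift (fun v : k.-tuple A =>
    tens [tuple ksign (susp G) (k - j.+1)%N (tnth v j) | j < k]).

Lemma desusp_multilinear k :
  multilinear (fun w : k.-tuple A => tval w) (fun v : k.-tuple A =>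
    tens [tuple ksign (susp G) (k - j.+1)%N (tnth v j) | j < k]).
Proof.
pose f j : A -> A := ksign (susp G) (k - j.+1)%N.
pose h (w : seq A) := mkseq (fun j => f j (nth 0 w j)) (size w).
have E (w : k.-tuple A) :
    tval [tuple ksign (susp G) (k - j.+1)%N (tnth w j) | j < k] = h w.
  apply: (@eq_from_nth _ 0); rewrite size_tuple ?size_mkseq ?size_tuple // => i ik.
  rewrite nth_mkseq ?size_tuple // -[i]/(val (Ordinal ik)) -tnth_nth tnth_mktuple.
  by rewrite (tnth_nth 0).
have H u a v : h (u ++ a :: v)
    = h u ++ f (size u) a :: mkseq (fun j => f ((size u).+1 + j)%N (nth 0 v j)) (size v).
  rewrite /h size_cat /= /mkseq iotaD map_cat /= add0n; congr (_ ++ _).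
    by apply/eq_in_map => j; rewrite mem_iota nth_cat /= add0n => ->.
  rewrite nth_cat ltnn subnn /=; congr (_ :: _).
  rewrite -[in LHS](addn0 (size u).+1) iotaDl -map_comp; apply: eq_map => j /=.
  by rewrite nth_cat ltnNge ltnW ?ltnS ?leq_addr //= addSn -addnS addKn.
move=> x y z u v c a b hx hy hz.
apply: pure_multilinear; rewrite E.
- by rewrite hx H /f ksign_linear; reflexivity.
- by rewrite hy H; reflexivity.
- by rewrite hz H; reflexivity.
Qed.

Lemma desusp_tens k (d : k.-tuple int) (v : k.-tuple A) :
  homog_tuple (susp G) d v ->
  desusp (tens v) =
    sgn K (\sum_(j < k) (k - j.+1)%N%:Z * tnth d j) *: tens v.
Proof.
move=> hv; rewrite /desusp tliftE; last exact: desusp_multilinear.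
have tensE (w : k.-tuple A) : tens w = tensl k w.
  by congr tens; apply: eq_from_tnth => i; rewrite tnth_mktuple -tnth_nth.
have aux (I : Type) (s : seq I) (c : I -> K) (x : I -> A) pre :
    (size pre + size s)%N = k ->
    tensl k (pre ++ [seq c i *: x i | i <- s])
    = (\prod_(i <- s) c i) *: tensl k (pre ++ [seq x i | i <- s]).
  elim: s pre => [|i s IH] pre /= hs; first by rewrite big_nil scale1r.
  have tZ y : tensl k (pre ++ (c i *: y) :: [seq c i *: x i | i <- s])
      = c i *: tensl k (pre ++ y :: [seq c i *: x i | i <- s]).
    have hm e y1 y2 := @tensl_multilinear _ _ k pre [seq c i *: x i | i <- s] e y1 y2.
    have t0 : tensl k (pre ++ 0 :: [seq c i *: x i | i <- s]) = 0.
      have := hm 1 0 0; rewrite size_map !scale1r addr0 => /(_ hs).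
      by move/(congr1 (fun w => w - tensl k (pre ++ 0 :: [seq c i *: x i | i <- s])));
         rewrite addrK subrr.
    by rewrite -[c i *: y]addr0 hm ?size_map // t0 addr0.
  rewrite tZ -cat_rcons IH ?size_rcons ?addSnnS // cat_rcons.
  by rewrite scalerA big_cons.
rewrite !tensE.
pose c (j : 'I_k) := sgn K ((k - j.+1)%N%:Z * tnth d j).
have -> : tval [tuple ksign (susp G) (k - j.+1)%N (tnth v j) | j < k]
    = [seq c j *: tnth v j | j <- enum 'I_k].
  by rewrite /= enumT; apply: eq_map => j; rewrite (ksign_homog _ (hv j)).
rewrite -[[seq _ | _ <- _]]/([::] ++ _) aux ?size_enum_ord // cat0s.
rewrite map_tnth_enum big_enum /=; congr (_ *: _).
rewrite /c /sgn; elim/big_rec2: _ => [|j m e _ ->]; first by rewrite expr0z.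
by rewrite exprzDr ?unitrN1.
Qed.

(* rho_k = s o mu_k o (s^{-1})^{(x) k} *)
Definition susp_op (mu : opfam A) : opfam A :=
  fun k t => mu k (desusp t).

End HAinfinity.

(* Main.v *)
(* Write [T n] for the twisted coderivation of [rho n].  Expanding
   [T m (T n w)] on a word [w], the summands in which the two operations are
   applied to disjoint groups of letters cancel against those of
   [T n (T m w)], because [rho m] and [rho n] are odd and commute with [alpha].
   The remaining summands with [m + n = k] carry the common twist [alpha^k]
   outside, so they form the twisted coderivation of
   [square_op k : V^{(x) k+1} -> V].  Hence [D o D = 0] iff every [square_op k]
   vanishes, and [square_op k] is also the projection of [D o D] to [V] on words
   of length [k+1].  On homogeneous elements, [square_op k] of [susp_op mu] is,
   up to the sign of [(s^{-1})^{(x) k+1}], the [HA_infinity] identity of arity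
   [k+1].  Finally [D] determines [rho], which is its projection to [V], and
   [susp_op] is an involution. *)
From HB Require Import structures.
Require Import Defs.
From mathcomp Require Import all_boot all_order all_algebra.
From mathcomp Require Import boolp classical_sets functions fsbigop.
From mathcomp Require Import freeg zify ring.

Set Implicit Arguments.
Unset Strict Implicit.
Unset Printing Implicit Defensive.

Import GRing.Theory.
Local Open Scope classical_set_scope.
Local Open Scope ring_scope.

(** * Linear extensionality and homogeneous words *)

Section LinearMaps.
Variables (K : fieldType) (U W : lmodType K) (f : U -> W).
Hypothesis fL : linear f.

Let g : {linear U -> W} := HB.pack f (GRing.isLinear.Build _ _ _ _ f fL).

Lemma lin0 : f 0 = 0. Proof. exact: (linear0 g). Qed.
Lemma linN x : f (- x) = - f x. Proof. exact: (linearN g). Qed.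
Lemma linZ c x : f (c *: x) = c *: f x. Proof. exact: (linearZ_LR g). Qed.
Lemma lin_sum (I : Type) (r : seq I) (P : pred I) (F : I -> U) :
  f (\sum_(i <- r | P i) F i) = \sum_(i <- r | P i) f (F i).
Proof. exact: (linear_sum g). Qed.

End LinearMaps.

Lemma iter_linear (K : fieldType) (U : lmodType K) (f : U -> U) n :
  linear f -> linear (iter n f).
Proof. by move=> fL; elim: n => // n IH c x y; rewrite !iterS IH fL. Qed.

Lemma sgnD (K : fieldType) a b : sgn K (a + b) = sgn K a * sgn K b.
Proof. by rewrite /sgn exprzDr ?unitrN1. Qed.

Lemma sgn_double (K : fieldType) a : sgn K (2 * a) = 1.
Proof. by rewrite /sgn -exprz_exp -exprnP sqrrN expr1n exp1rz. Qed.

Lemma sgn_sqr (K : fieldType) a : sgn K a * sgn K a = 1.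
Proof. by rewrite -sgnD -(sgn_double K a); congr sgn; ring. Qed.

Lemma sgn_even (K : fieldType) a b c : a = b + 2 * c -> sgn K a = sgn K b.
Proof. by move=> ->; rewrite sgnD sgn_double mulr1. Qed.

Section TensorExtensionality.
Variables (K : fieldType) (V : lmodType K) (X : choiceType) (wd : X -> seq V).

(** A class has a representative in the free module, which is a finite combination of generators;
    the induction runs over its support. *)
Lemma tensor_ind (P : tensor wd -> Prop) :
  P 0 -> (forall c s t, P s -> P t -> P (c *: s + t)) ->
  (forall x, P (pure wd x)) -> forall t, P t.
Proof.
move=> P0 PD Pp t; rewrite -[t]tclassK -(freeg_sumE (repr t)).
elim: (dom _) => [|x s IH]; first by rewrite big_nil tclass0.
rewrite big_cons.
have cE : coeff x (repr t) *: << x >> = << coeff x (repr t) *g x >> :> {freeg X / K}.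
  by apply/eqP/freeg_eqP => y; rewrite coeffZ !coeffU mul1r.
by rewrite -cE tclass_linear; exact: PD _ _ _ (Pp x) IH.
Qed.

Lemma tensor_eq (W : lmodType K) (f g : tensor wd -> W) : linear f -> linear g ->
  (forall x, f (pure wd x) = g (pure wd x)) -> f =1 g.
Proof.
move=> fL gL fg; apply: tensor_ind => //; first by rewrite !lin0.
by move=> c s t fs ft; rewrite fL gL fs ft.
Qed.

End TensorExtensionality.

Lemma tens_tensl (K : fieldType) (V : lmodType K) n (w : n.-tuple V) :
  tens w = tensl n w.
Proof. by congr tens; apply: eq_from_tnth => i; rewrite tnth_mktuple -tnth_nth. Qed.

Section HomogeneousWords.
Variables (K : fieldType) (V : lmodType K) (G : grading V).

(** List form of [homog_tuple]: words can be cut and concatenated without carrying length proofs in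
    the types. *)
Fixpoint hword (d : seq int) (w : seq V) : Prop :=
  match d, w with
  | [::], [::] => True
  | i :: d', x :: w' => homog G i x /\ hword d' w'
  | _, _ => False
  end.

Lemma hword_size d w : hword d w -> size d = size w.
Proof. by elim: d w => [|i d IH] [|x w] //= [_ /IH->]. Qed.

Lemma hword_cat d1 d2 w1 w2 :
  hword d1 w1 -> hword d2 w2 -> hword (d1 ++ d2) (w1 ++ w2).
Proof.
by elim: d1 w1 => [|i d IH] [|x w] //= [hx hw] h2; split=> //; exact: IH.
Qed.

Lemma hword_take n d w : hword d w -> hword (take n d) (take n w).
Proof. by elim: d w n => [|i d IH] [|x w] [|n] //= [hx hw]; auto. Qed.

Lemma hword_drop n d w : hword d w -> hword (drop n d) (drop n w).
Proof. by elim: d w n => [|i d IH] [|x w] [|n] //= [hx hw]; auto. Qed.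

Lemma hword_map (f : V -> V) d w : (forall i x, homog G i x -> homog G i (f x)) ->
  hword d w -> hword d (map f w).
Proof. by move=> hf; elim: d w => [|i d IH] [|x w] //= [hx hw]; auto. Qed.

Lemma hword_tuple n (d : n.-tuple int) (w : n.-tuple V) :
  homog_tuple G d w <-> hword d w.
Proof.
case: d w => [d /= sd'] [w /= sw']; have sd := eqP sd'; have sw := eqP sw'.
pose P := forall j, (j < n)%N -> homog G (nth 0 d j) (nth 0 w j).
transitivity P.
  split=> [h j jn|h i]; last by rewrite !(tnth_nth 0) /=; exact: h.
  by have := h (Ordinal jn); rewrite !(tnth_nth 0).
rewrite {}/P {sd' sw'}; elim: d n w sd sw => [|i d IH] [|n] [|x w] //= [sd] [sw].
rewrite -(IH n) //; split=> [h|[hx h] [|j] //]; last exact: h.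
by split=> [|j]; [exact: (h 0%N) | exact: (h j.+1)].
Qed.

(** The length is fixed because [tensl n] truncates longer lists, so that [rho n] composed with
    [tensl n.+1] is multilinear only on words of length [n.+1]. *)
Definition multilinear_at (W : lmodType K) N (f : seq V -> W) :=
  forall u v c a b, (size u + (size v).+1)%N = N ->
  f (u ++ (c *: a + b) :: v) = c *: f (u ++ a :: v) + f (u ++ b :: v).

(** Letters are replaced one at a time by their homogeneous components; in the proof [pre] is the
    part of the word already treated. *)
Lemma multilinear_at_eq0 (W : lmodType K) N (f : seq V -> W) :
  multilinear_at N f -> (forall d w, size w = N -> hword d w -> f w = 0) ->
  forall w, size w = N -> f w = 0.
Proof.
move=> fM f0 w sw.
suff aux pre dpre : hword dpre pre -> (size pre + size w)%N = N -> f (pre ++ w) = 0.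
  by apply: (aux [::] [::]).
elim: w pre dpre {sw} => [|x w IH] pre dpre hpre sN.
  by rewrite cats0; apply: (f0 dpre) => //; rewrite -sN addn0.
have fL : linear (fun y => f (pre ++ y :: w)) by move=> c a b; exact: fM.
have [s _ ->] := proj_sum G x; rewrite (lin_sum fL) big1 // => i _.
rewrite -cat_rcons; apply: (IH _ (rcons dpre i)); last by rewrite size_rcons addSnnS.
by rewrite -!cats1; apply: hword_cat => //=; split=> //; rewrite /homog projK eqxx.
Qed.

Lemma multilinear_at_map_ksign (W : lmodType K) (f : seq V -> W) p d w :
  multilinear_at (size w) f -> hword d w ->
  f (map (ksign G p) w) = sgn K (p * \sum_(i <- d) i) *: f w.
Proof.
move=> fM hw.
suff aux pre : multilinear_at (size pre + size w)%N f -> f (pre ++ map (ksign G p) w)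
    = sgn K (p * \sum_(i <- d) i) *: f (pre ++ w) by exact: (aux [::]).
elim: d w pre hw {fM} => [|i d IH] [|x w] //= pre.
  by rewrite big_nil mulr0 /sgn expr0z scale1r.
move=> [hx hw] fM; rewrite (ksign_homog p hx).
have fL : linear (fun y => f (pre ++ y :: map (ksign G p) w)).
  by move=> c a b; apply: fM; rewrite size_map.
rewrite (linZ fL) -[in LHS]cat_rcons IH // ?cat_rcons; last first.
  by rewrite size_rcons addSnnS.
by rewrite scalerA big_cons mulrDr sgnD.
Qed.

Lemma ksignD p q x : ksign G p (ksign G q x) = ksign G (p + q) x.
Proof.
have [s us xE] := proj_sum G x; rewrite xE !(lin_sum (ksign_linear G _)).
apply: eq_bigr => i _; have hx : homog G i (proj G i x) by rewrite /homog projK eqxx.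
by rewrite !(ksign_homog _ hx) (linZ (ksign_linear G _)) (ksign_homog _ hx)
  scalerA -sgnD; congr (sgn _ _ *: _); ring.
Qed.

Lemma ksignK p : involutive (ksign G p).
Proof.
move=> x; rewrite ksignD; have [s us xE] := proj_sum G x.
rewrite {2}xE {1}xE (lin_sum (ksign_linear G _)).
apply: eq_bigr => i _; rewrite (@ksign_homog _ _ _ _ i); last by rewrite /homog projK eqxx.
by rewrite mulrDl sgnD sgn_sqr scale1r.
Qed.

Lemma ksign_comm (f : V -> V) p x : linear f -> has_degree0 G f ->
  f (ksign G p x) = ksign G p (f x).
Proof.
move=> fL fd; have [s us xE] := proj_sum G x.
rewrite xE (lin_sum fL) !(lin_sum (ksign_linear G _)) (lin_sum fL).
apply: eq_bigr => i _; have hx : homog G i (proj G i x) by rewrite /homog projK eqxx.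
by rewrite (ksign_homog _ hx) (linZ fL) (ksign_homog _ (fd _ _ hx)).
Qed.

End HomogeneousWords.

(** * The square of a twisted coderivation *)

Section TensorAlgebra.
Variables (K : fieldType) (V : lmodType K).

Lemma word_linear (u v : seq V) : linear (fun x => word (u ++ x :: v)).
Proof. by move=> c a b; exact: word_multilinear. Qed.

Lemma word_cons_linear (v : seq V) : linear (fun x => word (x :: v)).
Proof. exact: (word_linear [::]). Qed.

(** Left multiplication by a letter in the tensor algebra, used for recursion on the first letter of
    a word. *)
Definition lcons (x : V) : talg V -> talg V := tlift (fun w => word (x :: w)).

Lemma lcons_multilinear x : multilinear id (fun w : seq V => word (x :: w)).
Proof. by move=> _ _ _ u v c a b /= -> -> ->; exact: (word_linear (x :: u)). Qed.

Lemma lcons_linear x : linear (lcons x).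
Proof. exact/tlift_linear/lcons_multilinear. Qed.

Lemma lcons_word x w : lcons x (word w) = word (x :: w).
Proof. exact/tliftE/lcons_multilinear. Qed.

(** The projection of [TV] onto its summand [V] of tensors of length one. *)
Definition letter : talg V -> V :=
  tlift (fun w : seq V => if w is [:: x] then x else 0).

Lemma letter_multilinear :
  multilinear id (fun w : seq V => if w is [:: x] then x else 0).
Proof.
move=> _ _ _ [|y u] v c a b /= -> -> ->; first by case: v => //; rewrite scaler0 addr0.
by case: u => [|? ?]; rewrite scaler0 addr0.
Qed.

Lemma letter_linear : linear letter.
Proof. exact/tlift_linear/letter_multilinear. Qed.

Lemma letter_word w : letter (word w) = if w is [:: x] then x else 0.
Proof. exact/tliftE/letter_multilinear. Qed.

End TensorAlgebra.

(** The square of pairs [(m, n)] is regrouped by [k = m + n]; the half with [k >= N] contributes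
    nothing. *)
Lemma antidiagonal_sum (M : nmodType) (F : nat -> nat -> M) N :
  (forall m n, (N <= m + n)%N -> F m n = 0) ->
  \sum_(0 <= n < N) \sum_(0 <= m < N) F m n
  = \sum_(0 <= k < N) \sum_(0 <= n < k.+1) F (k - n)%N n.
Proof.
move=> F0.
transitivity (\sum_(0 <= n < N) \sum_(0 <= k < N | (n <= k)%N) F (k - n)%N n).
  apply: eq_big_nat => n /andP[_ nN].
  rewrite -(big_nat_widenl _ _ _ xpredT) // [in LHS](@big_cat_nat _ _ _ (N - n)) ?leq_subr //=.
  rewrite [X in _ + X]big_nat [X in _ + X]big1 => [|m /andP[hm _]]; last by apply: F0; lia.
  by rewrite addr0 -[X in index_iota X N]add0n big_addn; apply: eq_bigr => m _; rewrite addnK.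
rewrite (exchange_big_dep_nat xpredT) //=.
apply: eq_big_nat => k /andP[_ kN].
rewrite [RHS](@big_nat_widen _ _ _ 0 k.+1 N) //.
Qed.

(** * Twisted coderivations of degree -1 on words, and their components in [V] *)

Section TwistedSquare.
Variables (K : fieldType) (V : lmodType K) (G : grading V) (alpha : V -> V).
Variable rho : opfam V.
Arguments rho : clear implicits.
Hypotheses (alphaL : linear alpha) (alpha0 : has_degree0 G alpha).
Hypotheses (rhoL : forall n, linear (rho n)).

Definition op n (w : seq V) : V := rho n (tensl n.+1 w).

(** The word inside [tilde_term], kept as a list so that a second operation can be applied to it. *)
Definition tword n i (v : seq V) : seq V :=
  [seq iter n alpha (ksign G (-1) x) | x <- take i v]
    ++ op n (take n.+1 (drop i v))
    :: [seq iter n alpha x | x <- drop (i + n.+1) v].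

Local Notation T n := (tilde G alpha (-1) (rho n)).

Let TL n : linear (T n). Proof. exact: tilde_linear. Qed.

Lemma tilde_tword n v :
  T n (word v) = \sum_(0 <= i < size v - n) word (tword n i v).
Proof. by rewrite /tilde tliftE //; exact: tilde_multilinear. Qed.

Lemma size_tword n i v : (i < size v - n)%N -> size (tword n i v) = (size v - n)%N.
Proof.
move=> h; rewrite size_cat /= !size_map size_drop size_take; case: ifP; lia.
Qed.

Lemma tilde_small n v : (size v <= n)%N -> T n (word v) = 0.
Proof. by move=> h; rewrite tilde_tword big_geq //; lia. Qed.

Lemma op_multilinear n : multilinear_at n.+1 (op n).
Proof. by move=> u v c a b h; rewrite /op tensl_multilinear // rhoL. Qed.

Lemma coder_fin t N : (forall n, (N <= n)%N -> T n t = 0) ->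
  coder G alpha (-1) rho t = \sum_(0 <= n < N) T n t.
Proof.
move=> h; rewrite /coder (fsbigE (index_iota 0 N)) ?iota_uniq //.
  by apply: eq_bigl => i; rewrite in_setT.
by move=> n _; rewrite mem_index_iota /= -leqNgt; exact: h.
Qed.

(** A sum with infinite support would take the default value 0; this bound makes the sum defining
    [coder] a genuine finite sum on every tensor. *)
Lemma coder_bound t : exists N, forall n, (N <= n)%N -> T n t = 0.
Proof.
elim/tensor_ind: t => [|c s t [M hM] [N hN]|w].
- by exists 0%N => n _; rewrite (lin0 (TL n)).
- exists (maxn M N) => n; rewrite geq_max => /andP[h1 h2].
  by rewrite TL hM // hN // scaler0 addr0.
- by exists (size w) => n; exact: tilde_small.
Qed.

Lemma coder_linear : linear (coder G alpha (-1) rho).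
Proof.
move=> c s t; have [M hM] := coder_bound s; have [N hN] := coder_bound t.
have hM' n : (maxn M N <= n)%N -> T n s = 0 by rewrite geq_max => /andP[/hM].
have hN' n : (maxn M N <= n)%N -> T n t = 0 by rewrite geq_max => /andP[_ /hN].
rewrite !(@coder_fin _ (maxn M N)) //; last first.
  by move=> n h; rewrite TL hM' // hN' // scaler0 addr0.
by rewrite scaler_sumr -big_split; apply: eq_bigr => n _; exact: TL.
Qed.

Lemma coder_word w :
  coder G alpha (-1) rho (word w)
  = \sum_(0 <= n < size w) \sum_(0 <= i < size w - n) word (tword n i w).
Proof.
rewrite (@coder_fin _ (size w)) => [|n]; last exact: tilde_small.
by apply: eq_bigr => n _; rewrite tilde_tword.
Qed.

(** [T n] shortens words by [n] letters, so on length [k.+1] only [n = k] leaves a single letter.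
    Hence [rho] can be read off from its coderivation. *)
Lemma letter_coder w k : size w = k.+1 ->
  letter (coder G alpha (-1) rho (word w)) = op k w.
Proof.
move=> sw; rewrite coder_word (lin_sum (@letter_linear _ _)) sw big_nat_recr //=.
rewrite big_nat big1 ?add0r => [|n /andP[_ nk]].
  rewrite subSnn big_nat1 letter_word /tword take0 drop0 -sw take_size add0n sw.
  by rewrite -sw drop_size.
rewrite (lin_sum (@letter_linear _ _)) big_nat big1 // => i /andP[_ hi].
rewrite letter_word; move: (@size_tword n i w); rewrite sw => /(_ hi).
by case: tword => [|x [|y u]] //= []; lia.
Qed.

(* The component [V^{(x) k+1} -> V] of [D o D]. *)
Definition square_op k (v : seq V) : V :=
  \sum_(0 <= n < k.+1) \sum_(0 <= i < (k - n).+1) op (k - n) (tword n i v).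

Lemma letter_coder2 w k : size w = k.+1 ->
  letter (coder G alpha (-1) rho (coder G alpha (-1) rho (word w)))
  = square_op k w.
Proof.
move=> sw; rewrite coder_word (lin_sum coder_linear) (lin_sum (@letter_linear _ _)).
rewrite sw /square_op; apply: eq_big_nat => n /andP[_ hn].
rewrite (lin_sum coder_linear) (lin_sum (@letter_linear _ _)) -subSn //.
apply: eq_big_nat => i /andP[_ hi]; apply: letter_coder.
by rewrite size_tword sw // subSn.
Qed.

(** * Consequences of odd degree and of commutation with [alpha] *)

Hypotheses (rhoD : forall n, tpow_degree G (-1) (rho n)).
Hypotheses (rhoC : forall n, tpow_commutes alpha (rho n)).

Let kap := ksign G (-1).

Lemma op_alpha n w : size w = n.+1 -> alpha (op n w) = op n (map alpha w).
Proof.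
move=> /eqP sw; pose t := Tuple sw.
by rewrite /op -[w]/(tval t) -tens_tensl rhoC tens_tensl.
Qed.

Lemma op_iter n m w : size w = n.+1 ->
  iter m alpha (op n w) = op n (map (iter m alpha) w).
Proof.
move=> sw; elim: m => [|m IH]; first by rewrite map_id.
by rewrite iterS IH op_alpha ?size_map // -map_comp.
Qed.

(** Oddness of [rho n] stated without degrees: it anticommutes with the parity map [kap]. This is
    the source of the sign by which disjoint terms cancel. *)
Lemma op_ksign n w : size w = n.+1 -> op n (map kap w) = - kap (op n w).
Proof.
move=> sw; apply/eqP; rewrite -addr_eq0; apply/eqP.
have kL : linear kap by exact: ksign_linear.
pose f w := op n (map kap w) + kap (op n w).
apply: (multilinear_at_eq0 (G := G) (f := f) _ _ sw) => {w sw} [u v c a b h|d w sw hw].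
  rewrite /f !map_cat /= kL !op_multilinear ?size_map // kL scalerDr.
  by rewrite addrACA.
have opM : multilinear_at (size w) (op n) by rewrite sw; exact: op_multilinear.
rewrite /f (multilinear_at_map_ksign _ opM hw).
have sd := hword_size hw; rewrite sw in sd.
have hop : homog G (\sum_(i <- d) i + -1) (op n w).
  pose t := Tuple (introT eqP sw); pose e := Tuple (introT eqP sd).
  rewrite /op -[w]/(tval t) -tens_tensl -[d]/(tval e).
  by apply: rhoD; apply/hword_tuple.
rewrite /kap (ksign_homog _ hop) -scalerDl.
have s1 : sgn K (-1 * -1) = -1 by rewrite mulrNN mulr1 /sgn expr1z.
by rewrite mulrDr sgnD s1 mulrN1 subrr scale0r.
Qed.

Lemma iter_degree0 n : has_degree0 G (iter n alpha).
Proof. by elim: n => // n IH i x hx; rewrite iterS; apply/alpha0/IH. Qed.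

Lemma iter_ksign n x : iter n alpha (kap x) = kap (iter n alpha x).
Proof. by apply: ksign_comm; [exact: iter_linear | exact: iter_degree0]. Qed.

(** An operation applied inside [p] twists the letters of [q] on its right without a sign. *)
Lemma tword_catl n i p q : (i < size p - n)%N ->
  tword n i (p ++ q) = tword n i p ++ map (iter n alpha) q.
Proof.
move=> h; have h1 : (i <= size p)%N by lia.
have h2 : (i + n.+1 <= size p)%N by lia.
have take_catl (s : seq V) k : (k <= size s)%N -> take k (s ++ q) = take k s.
  by rewrite take_cat; case: ltngtP => // -> _; rewrite subnn take0 cats0 take_size.
have drop_catl (s : seq V) k : (k <= size s)%N -> drop k (s ++ q) = drop k s ++ q.
  by rewrite drop_cat; case: ltngtP => // -> _; rewrite subnn drop0 drop_size.
rewrite /tword !take_catl // ?drop_catl // take_catl; last by rewrite size_drop; lia.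
by rewrite map_cat -catA.
Qed.

Lemma tword_catr n i p q :
  tword n (size p + i) (p ++ q)
  = [seq iter n alpha (kap x) | x <- p] ++ tword n i q.
Proof.
have drop_catr k : drop (size p + k) (p ++ q) = drop k q.
  by rewrite addnC -drop_drop drop_size_cat.
by rewrite /tword takeD take_size_cat // drop_size_cat // drop_catr -addnA drop_catr
  map_cat -catA.
Qed.

Lemma map_tword a n i v : (i < size v - n)%N ->
  map (iter a alpha) (tword n i v) = tword n i (map (iter a alpha) v).
Proof.
move=> h; have iterC x : iter a alpha (iter n alpha x) = iter n alpha (iter a alpha x).
  by rewrite -!iterD addnC.
rewrite /tword map_cat /= op_iter; last by rewrite size_takel // size_drop; lia.
rewrite -!map_drop -!map_take -!map_comp; congr (_ ++ _ :: _).
  by apply: eq_map => x /=; rewrite iterC iter_ksign.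
by apply: eq_map => x /=.
Qed.

(** * Expansion of [T m o T n] along the first letter *)

Definition lead n (v : seq V) : talg V :=
  if (n < size v)%N
  then word (op n (take n.+1 v) :: map (iter n alpha) (drop n.+1 v)) else 0.

(** Either the operation consumes the first letter, or it passes over it, leaving a twist and a
    sign, and acts on the rest. *)
Lemma tilde_cons n x v : T n (word (x :: v))
  = lead n (x :: v) + lcons (iter n alpha (kap x)) (T n (word v)).
Proof.
rewrite /lead; case: ltnP => h; last first.
  by rewrite !tilde_small // ?(lin0 (lcons_linear _)) ?addr0 //; apply: ltnW.
rewrite !tilde_tword (lin_sum (lcons_linear _)) /= subSn // big_nat_recl //=.
by congr (_ + _); apply: eq_bigr => i _; rewrite lcons_word.
Qed.

(* The terms of [T m (T n (word v))] in which [rho m] is applied at the start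
   of the word, to letters that include the value of [rho n]. *)
Definition nested m n (v : seq V) : talg V :=
  if (m + n < size v)%N
  then \sum_(0 <= i < m.+1) word (op m (tword n i (take (m + n).+1 v))
         :: map (iter (m + n) alpha) (drop (m + n).+1 v)) else 0.

(* The terms of [T m (T n (word v))] in which [rho n] is applied at the start
   of the word and [rho m] to later letters. *)
Definition disjoint_terms m n (v : seq V) : talg V :=
  if (n < size v)%N
  then lcons (iter m alpha (kap (op n (take n.+1 v))))
         (T m (word (map (iter n alpha) (drop n.+1 v)))) else 0.

Lemma lead_tword m n v :
  \sum_(0 <= i < size v - n) lead m (tword n i v)
  = nested m n v - disjoint_terms n m v.
Proof.
rewrite /nested /disjoint_terms; case: ltnP => h; last first.
  rewrite big_nat big1 => [|i /andP[_ hi]]; last first.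
    by rewrite /lead size_tword // ifF //; lia.
  case: ifP => _; last by rewrite subr0.
  by rewrite tilde_small ?(lin0 (lcons_linear _)) ?subr0 // size_map size_drop; lia.
have hm : (m < size v)%N by lia.
(* For [i <= m] the value of [rho n] is among the first [m.+1] letters, hence an argument of
   [rho m]; for larger [i] the two operations act on disjoint groups. *)
rewrite hm (@big_cat_nat _ _ _ m.+1) //=; last by lia.
congr (_ + _).
  apply: eq_big_nat => i /andP[_ hi].
  rewrite /lead size_tword; last by lia.
  have -> : (m < size v - n)%N by lia.
  rewrite -{1 2}[v](cat_take_drop (m + n).+1).
  have sp : size (take (m + n).+1 v) = (m + n).+1 by rewrite size_takel.
  have hi' : (i < size (take (m + n).+1 v) - n)%N by rewrite sp; lia.
  have st : size (tword n i (take (m + n).+1 v)) = m.+1.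
    by rewrite size_tword // sp; lia.
  rewrite tword_catl // take_size_cat // drop_size_cat // -map_comp.
  by congr (word (_ :: _)); apply: eq_map => y /=; rewrite iterD.
rewrite tilde_tword (lin_sum (lcons_linear _)) -sumrN size_map size_drop.
rewrite -[X in index_iota X _]add0n big_addn.
have -> : (size v - n - m.+1 = size v - m.+1 - n)%N by lia.
apply: eq_big_nat => i /andP[_ hi].
rewrite /lead size_tword; last by lia.
have -> : (m < size v - n)%N by lia.
have sp : size (take m.+1 v) = m.+1 by rewrite size_takel.
have := tword_catr n i (take m.+1 v) (drop m.+1 v).
rewrite sp cat_take_drop addnC => ->; rewrite take_size_cat ?size_map //.
rewrite drop_size_cat ?size_map // map_tword ?size_drop // lcons_word.
(* The signs and twists left by [rho n] are moved through [rho m]; by oddness this costs the minus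
   sign in front of [disjoint_terms]. *)
have -> : [seq iter n alpha (kap x) | x <- take m.+1 v]
    = map (iter n alpha) (map kap (take m.+1 v)) by rewrite -map_comp.
rewrite -op_iter ?size_map // op_ksign // (linN (iter_linear n alphaL)).
by rewrite (linN (word_cons_linear _)).
Qed.

(** Three cases: [rho m] acts at the start after [rho n]; [rho n] takes [x] and [rho m] passes over
    its value; or both pass over [x]. *)
Lemma tilde2_cons m n x w :
  T m (T n (word (x :: w)))
  = nested m n (x :: w) + (disjoint_terms m n (x :: w) - disjoint_terms n m (x :: w))
    + lcons (iter (m + n) alpha x) (T m (T n (word w))).
Proof.
transitivity (\sum_(0 <= i < size (x :: w) - n) lead m (tword n i (x :: w))
  + disjoint_terms m n (x :: w) + lcons (iter (m + n) alpha x) (T m (T n (word w)))).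
  rewrite /disjoint_terms; case: ltnP => h; last first.
    rewrite !(@tilde_small n) //; last exact: ltnW.
    by rewrite (lin0 (TL m)) (lin0 (lcons_linear _)) big_geq ?addr0 //; lia.
  rewrite !(@tilde_tword n) (lin_sum (TL m)) /= subSn // !big_nat_recl //=.
  rewrite !(lin_sum (TL m)) (lin_sum (lcons_linear _)).
  rewrite {1}/tword take0 drop0 /= tilde_cons.
  under eq_bigr => i _.
    rewrite [tword n i.+1 _]/= tilde_cons.
    (* Both operations pass over [x]: the two signs cancel and the twists add up to [m + n]. *)
    rewrite -iter_ksign -/kap /kap ksignK -/kap -iterD.
  over.
  by rewrite big_split /= -!addrA; congr (_ + _); rewrite addrCA.
by rewrite lead_tword (addrAC (nested _ _ _)) addrA.
Qed.

(** * Vanishing of [D o D] *)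

Local Notation D := (coder G alpha (-1) rho).

Lemma tilde2_small m n w : (size w <= m + n)%N -> T m (T n (word w)) = 0.
Proof.
move=> h; rewrite tilde_tword (lin_sum (TL m)) big_nat big1 // => i /andP[_ hi].
by rewrite tilde_small // size_tword //; lia.
Qed.

Section SquareZero.
Hypothesis square_op0 :
  forall k d v, size v = k.+1 -> hword G d v -> square_op k v = 0.

(** Induction on the word through [tilde2_cons]: for fixed [m + n = k] the disjoint terms cancel in
    pairs, and the nested ones add up to [square_op k] on the first [k.+1] letters. *)
Lemma antidiagonal_eq0 k d w : hword G d w ->
  \sum_(0 <= n < k.+1) T (k - n)%N (T n (word w)) = 0.
Proof.
elim: w d => [|x w IH] d hw.
  by rewrite big1 // => n _; rewrite tilde2_small.
have hwt : exists d', hword G d' w by case: d hw => [|i d] //= [_]; exists d.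
have [d' /IH IHw] := hwt.
under eq_big_nat => n /andP[_ hn] do rewrite tilde2_cons subnK //.
rewrite !big_split /= -(lin_sum (lcons_linear _)) IHw (lin0 (lcons_linear _)) addr0.
(* Reversing the summation, [n] to [k - n], exchanges the roles of the two operations in the
   subtracted sum. *)
rewrite sumrN [X in _ - X]big_nat_rev /= [X in _ - X](_ : _ = 
  \sum_(0 <= n < k.+1) disjoint_terms (k - n) n (x :: w)); last first.
  by apply: eq_big_nat => n /andP[_ hn]; rewrite add0n subSS subKn.
rewrite subrr addr0.
under eq_big_nat => n /andP[_ hn] do rewrite /nested subnK //.
case: (ltnP k (size (x :: w))) => hk; last by rewrite big1.
under eq_bigr => n _ do rewrite -(lin_sum (word_cons_linear _)).
rewrite -(lin_sum (word_cons_linear _)).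
have := square_op0 (k := k) (d := take k.+1 d) (v := take k.+1 (x :: w)).
rewrite /square_op => ->; first exact: (lin0 (word_cons_linear _)).
  by rewrite size_takel.
exact: hword_take.
Qed.

Lemma coder2_eq0 t : D (D t) = 0.
Proof.
apply: (tensor_eq (f := fun t => D (D t)) (g := fun=> 0)) => {t} [||w].
- by move=> c s t; rewrite !coder_linear.
- by move=> c s t; rewrite scaler0 addr0.
apply: (multilinear_at_eq0 (G := G) (f := fun w => D (D (word w)))
  (N := size w)) => // [u v c a b _|d {}w _ hw].
  by rewrite word_multilinear !coder_linear.
rewrite (@coder_fin (word w) (size w)) => [|n]; last exact: tilde_small.
rewrite (lin_sum coder_linear).
(* One bound serves for both indices, since [T m (T n (word w))] vanishes once [m + n] reaches the
   length of [w]. *)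
transitivity (\sum_(0 <= n < size w) \sum_(0 <= m < size w) T m (T n (word w))).
  apply: eq_bigr => n _; apply: coder_fin => m hm.
  by apply: tilde2_small; apply: leq_trans hm (leq_addr _ _).
rewrite (antidiagonal_sum (F := fun m n => T m (T n (word w)))) => [|m n].
  by apply: big1 => k _; exact: antidiagonal_eq0 hw.
exact: tilde2_small.
Qed.

End SquareZero.

Lemma coder2_eq0P : (forall t, D (D t) = 0) <->
  (forall k d v, size v = k.+1 -> hword G d v -> square_op k v = 0).
Proof.
split=> [D0 k d v sv _|]; last exact: coder2_eq0.
by rewrite -letter_coder2 // D0 (lin0 (@letter_linear _ _)).
Qed.

End TwistedSquare.

(** * Suspension and Koszul signs *)

(** The Koszul exponent of the desuspension: each letter is crossed by one desuspension for every
    letter to its right. The recursive form splits over concatenation. *)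
Fixpoint desusp_exponent (d : seq int) : int :=
  if d is i :: d' then (size d')%:Z * i + desusp_exponent d' else 0.

Lemma desusp_exponent_cat d1 d2 : desusp_exponent (d1 ++ d2)
  = desusp_exponent d1 + (size d2)%:Z * (\sum_(i <- d1) i) + desusp_exponent d2.
Proof.
elim: d1 => [|i d1 IH] /=; first by rewrite big_nil mulr0 !add0r.
by rewrite big_cons IH size_cat PoszD; ring.
Qed.

Lemma desusp_exponentE k (d : seq int) : size d = k ->
  desusp_exponent d = \sum_(j < k) (k - j.+1)%N%:Z * nth 0 d j.
Proof.
move=> <-; elim: d => [|i d IH]; first by rewrite big_ord0.
by rewrite big_ord_recl /= subSS subn0 IH.
Qed.

Lemma sum_shift (d : seq int) (c : int) :
  \sum_(i <- d) (i + c) = \sum_(i <- d) i + c * (size d)%:Z.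
Proof.
rewrite big_split /= big_const_seq count_predT iter_addr_0.
by rewrite -mulr_natr natz.
Qed.

(** The index [t] is determined by [r] and [s]; taking [s] outermost matches the order of summation
    in [square_op]. *)
Lemma triple_sum (M : nmodType) (F : nat -> nat -> nat -> M) k :
  \sum_(r < k.+1) \sum_(s < k.+1) \sum_(t < k.+1 | (r + s.+1 + t)%N == k.+1) F r s t
  = \sum_(0 <= s < k.+1) \sum_(0 <= r < (k - s).+1) F r s (k - s - r)%N.
Proof.
rewrite exchange_big /= big_mkord; apply: eq_big => [//|s _].
have hs := ltn_ord s; rewrite (@big_nat_widen _ _ _ 0 _ k.+1) ?ltnS ?leq_subr //.
rewrite big_mkord [RHS]big_mkcond; apply: eq_bigr => r _ /=.
case: ifP => h.
  have ht : (k - s - r < k.+1)%N by lia.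
  rewrite (big_pred1 (Ordinal ht)) // => t /=; rewrite -val_eqE /=; lia.
by rewrite big_pred0 // => t; lia.
Qed.

(** * Desuspension of tensor powers and of operations *)

Section Desuspension.
Variables (K : fieldType) (A : lmodType K) (G : grading A).

Lemma desusp_linear k : linear (desusp G (k := k)).
Proof. exact/tlift_linear/desusp_multilinear. Qed.

(** The suspension is the identity on the underlying space, so on homogeneous tensors [desusp] is
    multiplication by a sign. *)
Lemma desuspK k : involutive (desusp G (k := k)).
Proof.
apply: tensor_eq => [c s t||w]; first by rewrite !desusp_linear.
  by move=> c s t.
rewrite {2}/desusp tliftE; last exact: desusp_multilinear.
rewrite /desusp [LHS]tliftE; last exact: desusp_multilinear.
by congr tens; apply: eq_from_tnth => j; rewrite !tnth_mktuple ksignK.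
Qed.

Lemma hword_susp d v :
  hword (susp G) d v <-> hword G [seq i - 1 | i <- d] v.
Proof. by elim: d v => [|i d IH] [|x v] //=; rewrite IH. Qed.

Lemma desusp_tensl d v n : size v = n -> hword (susp G) d v ->
  desusp G (tensl n v) = sgn K (desusp_exponent d) *: tensl n v.
Proof.
move=> sv hv; have sd := hword_size hv; rewrite sv in sd.
pose t := Tuple (introT eqP sv); pose e := Tuple (introT eqP sd).
rewrite -[v]/(tval t) -tens_tensl (@desusp_tens _ _ _ _ e) ?(desusp_exponentE sd).
  by congr (sgn _ _ *: _); apply: eq_bigr => j _; rewrite (tnth_nth 0).
exact/hword_tuple.
Qed.

Lemma homogZ (H : grading A) i c x : homog H i x -> homog H i (c *: x).
Proof. by move=> hx; rewrite /homog (linZ (proj_linear H i)) hx. Qed.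

Variable (alpha : A -> A).
Hypotheses (alphaL : linear alpha) (alpha0 : has_degree0 G alpha).

Lemma susp_degree0 : has_degree0 (susp G) alpha.
Proof. by move=> i x; exact: alpha0. Qed.

Variables (k : nat) (f : tpow A k -> A).
Hypothesis fL : linear f.

Lemma desusp_comp_linear : linear (fun t => f (desusp G t)).
Proof. by move=> c s t; rewrite desusp_linear fL. Qed.

Lemma desusp_comp_commutes :
  tpow_commutes alpha f -> tpow_commutes alpha (fun t => f (desusp G t)).
Proof.
move=> fC x; rewrite /desusp !tliftE; try exact: desusp_multilinear.
rewrite fC; congr (f (tens _)); apply: eq_from_tnth => j.
by rewrite !(tnth_map, tnth_mktuple) ksign_comm //; exact: susp_degree0.
Qed.

(** The shifts of the [k] inputs absorb the [k] in [k - 2], and the shift of the output turns -2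
    into -1. *)
Lemma desusp_comp_degree : tpow_degree G (k%:Z - 2) f ->
  tpow_degree (susp G) (-1) (fun t => f (desusp G t)).
Proof.
move=> fD d x hx; rewrite (desusp_tens hx) (linZ fL); apply: homogZ.
have hx' : homog_tuple G (map_tuple (fun i => i - 1) d) x.
  by move=> j; rewrite tnth_map; exact: hx.
have := fD _ _ hx'; rewrite /= big_map sum_shift size_tuple /homog /= /susp_proj.
by congr (proj G _ _ = _); ring.
Qed.

Lemma desusp_comp_degree_inv : tpow_degree (susp G) (-1) f ->
  tpow_degree G (k%:Z - 2) (fun t => f (desusp G t)).
Proof.
move=> fD d x hx.
have hx' : homog_tuple (susp G) (map_tuple (fun i => i + 1) d) x.
  by move=> j; rewrite tnth_map /homog /= /susp_proj addrK; exact: hx.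
rewrite (desusp_tens hx') (linZ fL); apply: homogZ.
have := fD _ _ hx'; rewrite /= big_map sum_shift size_tuple /homog /= /susp_proj.
by congr (proj G _ _ = _); ring.
Qed.

End Desuspension.

(** * Comparison of the [HA_infinity] identities with [square_op] *)

Section Identities.
Variables (K : fieldType) (A : lmodType K) (G : grading A) (alpha : A -> A).
Hypotheses (alphaL : linear alpha) (alpha0 : has_degree0 G alpha).
Variable mu : opfam A.
Arguments mu : clear implicits.

Definition HA_term (d : seq int) (a : seq A) (r s t : nat) : A :=
  sgn K (r * s.+1 + t)%N *:
  (sgn K ((s.+1%:Z - 2) * \sum_(i <- take r d) i) *:
   op mu (r + t) ([seq iter s alpha x | x <- take r a]
     ++ op mu s (take s.+1 (drop r a))
     :: [seq iter s alpha x | x <- drop (r + s.+1) a])).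

Let rho := susp_op G mu.
Arguments rho : clear implicits.

Section Signs.
Hypotheses (muL : forall k, linear (mu k)).
Hypotheses (muD : forall k, tpow_degree G (k.+1%:Z - 2) (mu k)).

Let rhoL n : linear (rho n). Proof. exact: desusp_comp_linear. Qed.

Lemma op_susp n d w : size w = n.+1 -> hword (susp G) d w ->
  op rho n w = sgn K (desusp_exponent d) *: op mu n w.
Proof. by move=> sw hw; rewrite /op /rho /susp_op (desusp_tensl sw hw) (linZ (@muL n)). Qed.

(** The sign comparison. The left side carries the exponents of the inner and the outer desuspension
    and the sign of the coderivation; they agree modulo 2 with the exponent of the whole word plus
    the two signs of the identity. *)
Lemma op_tword_susp k n i d v : size v = k.+1 -> hword (susp G) d v ->
  (n <= k)%N -> (i <= k - n)%N ->
  op rho (k - n) (tword (susp G) alpha rho n i v)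
  = sgn K (desusp_exponent d)
    *: HA_term [seq j - 1 | j <- d] v i n (k - n - i).
Proof.
move=> sv hv nk ik; have sd := hword_size hv.
have hL := hword_take i hv; have hM := hword_take n.+1 (hword_drop i hv).
have hR := hword_drop (i + n.+1) hv.
rewrite /tword /HA_term subnKC //; set m := (k - n)%N; set t := (m - i)%N.
have dE : d = take i d ++ take n.+1 (drop i d) ++ drop (i + n.+1) d.
  by rewrite [(i + _)%N]addnC -drop_drop !cat_take_drop.
have sL : size (take i d) = i by rewrite size_takel // sd; lia.
have sM : size (take n.+1 (drop i d)) = n.+1 by rewrite size_takel // size_drop sd; lia.
have sR : size (drop (i + n.+1) d) = t by rewrite size_drop sd sv /t /m; lia.
rewrite -map_take big_map sum_shift {1}dE.
(* From here only the lengths and degrees of the three pieces matter. *)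
move: (take i d) (take n.+1 (drop i d)) (drop (i + n.+1) d) hL hM hR sL sM sR.
move=> dL dM dR; move: (take i v) (take n.+1 (drop i v)) (drop (i + n.+1) v).
move=> vL vM vR hL hM hR sL sM sR {dE}.
have zL := hword_size hL; have zM := hword_size hM; have zR := hword_size hR.
have szM : size vM = n.+1 by rewrite -zM.
have imt : (i + t)%N = m by rewrite subnKC.
set y := op mu n vM.
have hy : homog (susp G) (\sum_(j <- dM) j - 1) y.
  (* Up to a sign [y] is a value of [rho n], whose degree in the suspension is -1. *)
  have -> : y = sgn K (desusp_exponent dM) *: op rho n vM.
    by rewrite (op_susp szM hM) scalerA sgn_sqr scale1r.
  apply: homogZ; have sdM := sM.
  pose u := Tuple (introT eqP szM); pose e := Tuple (introT eqP sdM).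
  rewrite /op -[vM]/(tval u) -tens_tensl -[dM]/(tval e).
  by apply: desusp_comp_degree => //; apply/hword_tuple.
rewrite (op_susp szM hM) -/y.
have -> : [seq iter n alpha (ksign (susp G) (-1) x) | x <- vL]
    = map (ksign (susp G) (-1)) (map (iter n alpha) vL).
  rewrite -map_comp; apply: eq_map => x /=.
  by apply: ksign_comm; [exact: iter_linear | exact: (iter_degree0 (susp_degree0 alpha0))].
have hmap e w : hword (susp G) e w -> hword (susp G) e (map (iter n alpha) w).
  by apply: hword_map => j x; exact: (iter_degree0 (susp_degree0 alpha0)).
move/hmap: hL; move/hmap: hR; rewrite -(size_map (iter n alpha)) in zL.
rewrite -(size_map (iter n alpha)) in zR.
move: (map _ vL) (map _ vR) zL zR => wL wR zL zR hR hL.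
have opM := op_multilinear (rho := rho) rhoL (n := m).
have opL : linear (fun x => op rho m (map (ksign (susp G) (-1)) wL ++ x :: wR)).
  by move=> c a b; apply: opM; rewrite size_map -zL -zR sL sR addnS imt.
rewrite (linZ opL).
have opL2 : multilinear_at (size wL) (fun w => op rho m (w ++ y :: wR)).
  move=> u w c a b h; rewrite -!catA !cat_cons; apply: opM.
  by rewrite size_cat /= -addSn addnA h -zL -zR sL sR addnS imt.
rewrite (multilinear_at_map_ksign _ opL2 hL).
have hw : hword (susp G) (dL ++ (\sum_(j <- dM) j - 1) :: dR) (wL ++ y :: wR).
  exact: hword_cat.
rewrite (op_susp _ hw); last by rewrite size_cat /= -zL -zR sL sR addnS imt.
rewrite !scalerA -!sgnD; congr (_ *: _).
(* The witness is half the difference of the two exponents. *)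
apply: (@sgn_even _ _ _ (- (n%:Z * (\sum_(j <- dL) j) + t%:Z + i%:Z))).
rewrite !desusp_exponent_cat /= size_cat sL sM sR -(addn1 n) -(addn1 t) !PoszD !PoszM !PoszD.
by ring.
Qed.

Lemma square_op_susp k d v : size v = k.+1 -> hword (susp G) d v ->
  square_op (susp G) alpha rho k v = sgn K (desusp_exponent d) *:
   \sum_(r < k.+1) \sum_(s < k.+1) \sum_(t < k.+1 | (r + s.+1 + t)%N == k.+1)
     HA_term [seq j - 1 | j <- d] v r s t.
Proof.
move=> sv hv; rewrite triple_sum scaler_sumr; apply: eq_big_nat => n /andP[_ hn].
rewrite scaler_sumr; apply: eq_big_nat => i /andP[_ hi].
exact: op_tword_susp.
Qed.

End Signs.

(** The two identities differ by the sign of [desusp_exponent], which is its own inverse, and by the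
    shift of all degrees by one. *)
Lemma HAinfP : HAinf G alpha mu <->
  [/\ forall k, linear (mu k), forall k, tpow_degree G (k.+1%:Z - 2) (mu k),
      forall k, tpow_commutes alpha (mu k)
    & forall k d v, size v = k.+1 -> hword (susp G) d v ->
      square_op (susp G) alpha rho k v = 0].
Proof.
split=> -[muL muD muC muE]; split=> //.
  move=> k d v sv hv; rewrite (square_op_susp muL muD sv hv).
  have sd := hword_size hv; rewrite sv in sd.
  have sd' : size [seq j - 1 | j <- d] == k.+1 by rewrite size_map sd.
  have := muE k.+1 (Tuple sd') (Tuple (introT eqP sv)) isT.
  move=> -> //; first by rewrite scaler0.
  by apply/hword_tuple; exact/hword_susp.
case=> // k d a _ hda; pose e := [seq j + 1 | j <- d].
have de : tval d = [seq j - 1 | j <- e].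
  by rewrite -map_comp map_id_in // => j _ /=; rewrite addrK.
have ha : hword (susp G) e a by apply/hword_susp; rewrite -de; exact/hword_tuple.
have := muE k e a (size_tuple a) ha; rewrite (square_op_susp muL muD (size_tuple a) ha).
rewrite -de => /(congr1 (fun x => sgn K (desusp_exponent e) *: x)).
by rewrite scalerA sgn_sqr scale1r scaler0.
Qed.

End Identities.

(** * The correspondence between structures and square-zero coderivations *)

Section Bijection.
Variables (K : fieldType) (A : lmodType K) (G : grading A) (alpha : A -> A).
Hypothesis alphaL : linear alpha.

Lemma susp_opK : involutive (susp_op G).
Proof.
move=> mu; apply: functional_extensionality_dep => k; apply/funext => t.
by rewrite /susp_op desuspK.
Qed.

Lemma coder_inj (rho rho' : opfam A) :
  (forall n, linear (@rho n)) -> (forall n, linear (@rho' n)) ->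
  coder G alpha (-1) rho = coder G alpha (-1) rho' -> rho = rho'.
Proof.
move=> rhoL rhoL' E; apply: functional_extensionality_dep => n; apply/funext.
apply: tensor_eq => // w.
have := letter_coder G alphaL rhoL (size_tuple w).
by rewrite E (letter_coder G alphaL rhoL' (size_tuple w)) /op -!tens_tensl.
Qed.

End Bijection.

Theorem theorem3p11 (K : fieldType) (A : lmodType K) (G : grading A)
    (alpha : A -> A)
    (charK : [pchar K] =i pred0)
    (alpha_linear : linear alpha)
    (alpha_degree0 : has_degree0 G alpha)
    (alpha_neq0 : exists x, alpha x != 0) :
  set_bij
    (HAinf G alpha)
    [set D | Coder (susp G) alpha (-1) D /\ forall t, D (D t) = 0]
    (fun mu => coder (susp G) alpha (-1) (susp_op G mu)).
Proof.
have alpha0 := susp_degree0 alpha_degree0.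
split.
- move=> mu /(HAinfP alpha_linear alpha_degree0)[muL muD muC muE].
  have rL n : linear (@susp_op _ _ G mu n) by exact: desusp_comp_linear.
  have rD n : tpow_degree (susp G) (-1) (@susp_op _ _ G mu n).
    exact: desusp_comp_degree.
  have rC n : tpow_commutes alpha (@susp_op _ _ G mu n) by exact: desusp_comp_commutes.
  by split; [exists (susp_op G mu) | apply/coder2_eq0P].
- move=> mu mu'; rewrite !inE => -[muL _ _ _] [muL' _ _ _] E.
  apply: (can_inj (@susp_opK _ _ G)).
  by apply: (coder_inj alpha_linear _ _ E) => n; exact: desusp_comp_linear.
(* Since [susp_op] is an involution, the preimage of the coderivation of [rho] is
   [susp_op G rho]. *)
- move=> D [[rho [rL rD rC ->]]] DD; exists (susp_op G rho); last by rewrite susp_opK.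
  apply/(HAinfP alpha_linear alpha_degree0); rewrite susp_opK; split=> [k|k|k|].
  + exact: desusp_comp_linear.
  + exact: desusp_comp_degree_inv.
  + exact: desusp_comp_commutes.
  + exact/coder2_eq0P.
Qed.
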